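(* Let $\mathcal C$ be an abelian category and let $X,Y:\mathcal C\to\mathcal C$ be endofunctors such that $Y$ is both left and right adjoint to $X$ and such that the biproducts $\bigoplus_{i\ge0}X^i(M)$ and $\bigoplus_{i\ge0}Y^i(M)$ exist for all $M\in\mathcal C$. (i) Assume that for every sequence $\cdots\to M^1\to M^0\to0$ of epimorphisms in $\mathcal C$ with $M^0\neq0$, the inverse limit $M^\infty$ (if it exists) satisfies $M^\infty\neq0$. Then $X$ satisfies the following equivalent conditions: (1) for $M\neq0$ in $\mathcal C$ there are no epimorphisms $X(M)\to M$ in $\mathcal C$; (2) for all $(M,h)\in\mathcal C^{T(X)}$, $\operatorname{top}_X(M,h)=0$ if and only if $(M,h)=0$; (3) for all morphisms $\varphi$ in $\mathcal C^{T(X)}$, $\operatorname{top}_X\varphi$ is an epimorphism if and only if $\varphi$ is an epimorphism. (ii) If $\mathcal C$ has enough projectives, then $\mathcal C$ satisfies the assumption in (i).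
   Context: All functors are additive. $X^0=\operatorname{Id}$. The biproduct $\bigoplus_iM_i$ exists if the coproduct and product exist and the canonical morphism $\coprod_iM_i\to\prod_iM_i$ is an isomorphism. $\mathcal C^{T(X)}$ is the Eilenberg–Moore category of the free monad $T(X)=\bigoplus_{i\ge0}X^i$; it is identified with the category of pairs $(M,h_1)$ with $h_1:X(M)\to M$ in $\mathcal C$, a morphism $(M,h_1)\to(N,g_1)$ being $\varphi:M\to N$ with $\varphi h_1=g_1X(\varphi)$. For $(M,h)\in\mathcal C^{T(X)}$, $h_1$ denotes its structure map $X(M)\to M$. $\operatorname{top}_X:\mathcal C^{T(X)}\to\mathcal C$ is the functor $(M,h)\mapsto\operatorname{Coker}h_1$. *)

(* Defs.v *)
From HB Require Import structures.
From mathcomp Require Import all_boot all_algebra.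
From mathcomp Require Import boolp.

Set Implicit Arguments.
Unset Strict Implicit.
Unset Printing Implicit Defensive.

Import GRing.Theory.
Local Open Scope ring_scope.

Declare Scope cat_scope.
Delimit Scope cat_scope with cat.

Record preadditive := Preadditive {
  obj :> Type;
  hom : obj -> obj -> zmodType;
  idm : forall A, hom A A;
  comp : forall A B D, hom B D -> hom A B -> hom A D;
  comp1m : forall A B (f : hom A B), comp (idm B) f = f;
  compm1 : forall A B (f : hom A B), comp f (idm A) = f;
  compA : forall A B D E (h : hom D E) (g : hom B D) (f : hom A B),
    comp h (comp g f) = comp (comp h g) f;
  compDl : forall A B D (g g' : hom B D) (f : hom A B),
    comp (g + g') f = comp g f + comp g' f;
  compDr : forall A B D (g : hom B D) (f f' : hom A B),
    comp g (f + f') = comp g f + comp g f' }.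

Arguments hom {p} A B.
Arguments idm {p} A.
Arguments comp {p A B D} g f.
Notation "g '\oC' f" := (comp g f) (at level 40, left associativity) : cat_scope.
Local Open Scope cat_scope.

Record functor (C D : preadditive) := Functor {
  fob :> C -> D;
  fmap : forall A B : C, hom A B -> hom (fob A) (fob B);
  fmap1 : forall A : C, fmap (idm A) = idm (fob A);
  fmapM : forall (A B E : C) (g : hom B E) (f : hom A B),
    fmap (g \oC f) = fmap g \oC fmap f;
  fmapD : forall (A B : C) (f g : hom A B), fmap (f + g) = fmap f + fmap g }.

Arguments fmap {C D} F {A B} _ : rename.

Section Theory.
Variable C : preadditive.

Lemma compm0 (A B D : C) (g : hom B D) : g \oC (0 : hom A B) = 0.
Proof. by apply: (addrI (g \oC (0 : hom A B))); rewrite -compDr !addr0. Qed.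

Lemma comp0m (A B D : C) (f : hom A B) : (0 : hom B D) \oC f = 0.
Proof. by apply: (addrI ((0 : hom B D) \oC f)); rewrite -compDl !addr0. Qed.

Lemma compNr (A B D : C) (g : hom B D) (f : hom A B) : g \oC (- f) = - (g \oC f).
Proof. by apply: (addrI (g \oC f)); rewrite -compDr !subrr compm0. Qed.

Lemma compNl (A B D : C) (g : hom B D) (f : hom A B) : (- g) \oC f = - (g \oC f).
Proof. by apply: (addrI (g \oC f)); rewrite -compDl !subrr comp0m. Qed.

Lemma fmap0 (D : preadditive) (F : functor C D) (A B : C) :
  fmap F (0 : hom A B) = 0.
Proof. by apply: (addrI (fmap F (0 : hom A B))); rewrite -fmapD !addr0. Qed.

Lemma fmapN (D : preadditive) (F : functor C D) (A B : C) (f : hom A B) :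
  fmap F (- f) = - fmap F f.
Proof. by apply: (addrI (fmap F f)); rewrite -fmapD !subrr fmap0. Qed.

Definition is_zero (A : C) : Prop :=
  (forall B, exists! f : hom A B, True) /\ (forall B, exists! f : hom B A, True).

Definition is_iso (A B : C) (f : hom A B) : Prop :=
  exists g : hom B A, g \oC f = idm A /\ f \oC g = idm B.

Definition is_mono (A B : C) (f : hom A B) : Prop :=
  forall T (g h : hom T A), f \oC g = f \oC h -> g = h.

Definition is_epi (A B : C) (f : hom A B) : Prop :=
  forall T (g h : hom B T), g \oC f = h \oC f -> g = h.

Definition is_kernel (A B K : C) (f : hom A B) (k : hom K A) : Prop :=
  f \oC k = 0 /\
  forall T (g : hom T A), f \oC g = 0 -> exists! u : hom T K, k \oC u = g.

Definition is_cokernel (A B Q : C) (f : hom A B) (q : hom B Q) : Prop :=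
  q \oC f = 0 /\
  forall T (g : hom B T), g \oC f = 0 -> exists! u : hom Q T, u \oC q = g.

Definition is_product (I : Type) (M : I -> C) (P : C)
    (pr : forall i, hom P (M i)) : Prop :=
  forall T (f : forall i, hom T (M i)),
    exists! u : hom T P, forall i, pr i \oC u = f i.

Definition is_coproduct (I : Type) (M : I -> C) (S : C)
    (inj : forall i, hom (M i) S) : Prop :=
  forall T (f : forall i, hom (M i) T),
    exists! u : hom S T, forall i, u \oC inj i = f i.

(* [c] is the unique morphism whose components [pr j \oC c \oC inj i] are
   identities for i = j and zero otherwise. *)
Definition is_canonical (I : Type) (M : I -> C) (S P : C)
    (inj : forall i, hom (M i) S) (pr : forall i, hom P (M i))
    (c : hom S P) : Prop :=
  (forall i, pr i \oC c \oC inj i = idm (M i)) /\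
  (forall i j, i <> j -> pr j \oC c \oC inj i = 0).

Definition has_biproduct (I : Type) (M : I -> C) : Prop :=
  exists (S P : C) (inj : forall i, hom (M i) S) (pr : forall i, hom P (M i))
         (c : hom S P),
    [/\ is_coproduct inj, is_product pr, is_canonical inj pr c & is_iso c].

Definition is_inverse_limit (M : nat -> C) (p : forall i, hom (M i.+1) (M i))
    (L : C) (pr : forall i, hom L (M i)) : Prop :=
  (forall i, p i \oC pr i.+1 = pr i) /\
  forall T (f : forall i, hom T (M i)), (forall i, p i \oC f i.+1 = f i) ->
    exists! u : hom T L, forall i, pr i \oC u = f i.

Definition is_projective (P : C) : Prop :=
  forall (A B : C) (e : hom A B), is_epi e ->
  forall f : hom P B, exists g : hom P A, e \oC g = f.

Definition enough_projectives : Prop :=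
  forall A : C, exists (P : C) (e : hom P A), is_projective P /\ is_epi e.

Definition epi_towers_have_nonzero_limits : Prop :=
  forall (M : nat -> C) (p : forall i, hom (M i.+1) (M i)),
    (forall i, is_epi (p i)) -> ~ is_zero (M 0%N) ->
  forall (L : C) (pr : forall i, hom L (M i)),
    is_inverse_limit p pr -> ~ is_zero L.

End Theory.

Arguments enough_projectives C : clear implicits.
Arguments epi_towers_have_nonzero_limits C : clear implicits.

Definition left_adjoint (C D : preadditive) (F : functor C D) (G : functor D C)
    : Prop :=
  exists phi : forall (A : C) (B : D), hom (F A) B -> hom A (G B),
    [/\ forall A B, bijective (phi A B),
        forall A A' B (a : hom A' A) (f : hom (F A) B),
          phi A' B (f \oC fmap F a) = phi A B f \oC a
      & forall A B B' (b : hom B B') (f : hom (F A) B),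
          phi A B' (b \oC f) = fmap G b \oC phi A B f].

Record is_abelian (C : preadditive) : Prop := IsAbelian {
  zero_object : exists Z : C, is_zero Z;
  binary_biproducts : forall A : bool -> C, has_biproduct A;
  kernels : forall (A B : C) (f : hom A B),
    exists (K : C) (k : hom K A), is_kernel f k;
  cokernels : forall (A B : C) (f : hom A B),
    exists (Q : C) (q : hom B Q), is_cokernel f q;
  mono_normal : forall (A B : C) (f : hom A B), is_mono f ->
    exists (D : C) (g : hom B D), is_kernel g f;
  epi_normal : forall (A B : C) (f : hom A B), is_epi f ->
    exists (D : C) (g : hom D A), is_cokernel g f }.

Record abelian_category := AbelianCategory {
  abelian_sort :> preadditive;
  abelianP : is_abelian abelian_sort }.

Section Coker.
Variable C : abelian_category.
Variables (A B : C) (f : hom A B).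

Definition coker : C := projT1 (cid (cokernels (abelianP C) f)).

Definition coker_map : hom B coker :=
  projT1 (cid (projT2 (cid (cokernels (abelianP C) f)))).

Lemma coker_mapP : is_cokernel f coker_map.
Proof. exact: projT2 (cid (projT2 (cid (cokernels (abelianP C) f)))). Qed.

Lemma coker_map_epi : is_epi coker_map.
Proof.
case: coker_mapP => q0 qU T g h gh.
have [|u [_ uq]] := qU T (h \oC coker_map); first by rewrite -compA q0 compm0.
by rewrite -(uq g) // -(uq h).
Qed.

End Coker.

Lemma coker_induced_proof (C : abelian_category) (A B A' B' : C)
    (f : hom A B) (f' : hom A' B') (a : hom A A') (b : hom B B') :
  b \oC f = f' \oC a ->
  exists u : hom (coker f) (coker f'), u \oC coker_map f = coker_map f' \oC b.
Proof.
move=> sq; have [_ qU] := coker_mapP f; have [q0 _] := coker_mapP f'.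
have [|u [? _]] := qU _ (coker_map f' \oC b); last by exists u.
by rewrite -compA sq compA q0 comp0m.
Qed.

(* Presented by the structure maps X(M) -> M; no monad has to be constructed,
   since algebras over the free monad T(X) are identified with such pairs. *)
Section EilenbergMoore.
Variables (C : preadditive) (X : functor C C).

Record em_obj := EMObj { em_base : C; em_str : hom (X em_base) em_base }.

Definition em_mor (M N : em_obj) : {pred hom (em_base M) (em_base N)} :=
  fun f => f \oC em_str M == em_str N \oC fmap X f.

Arguments em_mor M N : clear implicits.

Fact em_mor_zmod_closed M N : zmod_closed (em_mor M N).
Proof.
split=> [|f g]; rewrite !unfold_in.
  by rewrite fmap0 comp0m compm0.
move=> /eqP ef /eqP eg.
by rewrite fmapD fmapN compDl compDr compNl compNr ef eg.
Qed.

HB.instance Definition _ M N :=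
  GRing.isZmodClosed.Build _ (em_mor M N) (em_mor_zmod_closed M N).

Record em_hom (M N : em_obj) := EMHom {
  em_val :> hom (em_base M) (em_base N);
  em_valP : em_val \in em_mor M N }.

HB.instance Definition _ M N := [isSub for @em_val M N].
HB.instance Definition _ M N := [Choice of em_hom M N by <:].
HB.instance Definition _ M N := [SubChoice_isSubZmodule of em_hom M N by <:].

Lemma em_homE M N (f : em_hom M N) : f \oC em_str M = em_str N \oC fmap X f.
Proof. by apply/eqP; exact: em_valP. Qed.

Fact em_idm_subproof M : idm (em_base M) \in em_mor M M.
Proof. by rewrite unfold_in fmap1 comp1m compm1. Qed.

Definition em_idm M : em_hom M M := EMHom (em_idm_subproof M).

Fact em_comp_subproof M N P (g : em_hom N P) (f : em_hom M N) :
  em_val g \oC em_val f \in em_mor M P.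
Proof.
by rewrite unfold_in fmapM -compA (em_homE f) compA (em_homE g) compA.
Qed.

Definition em_comp M N P (g : em_hom N P) (f : em_hom M N) : em_hom M P :=
  EMHom (em_comp_subproof g f).

Definition EM : preadditive.
Proof.
apply: (@Preadditive em_obj (fun M N => em_hom M N) em_idm em_comp).
- by move=> *; apply: val_inj; rewrite /= comp1m.
- by move=> *; apply: val_inj; rewrite /= compm1.
- by move=> *; apply: val_inj; rewrite /= compA.
- by move=> *; apply: val_inj; rewrite /= compDl.
- by move=> *; apply: val_inj; rewrite /= compDr.
Defined.

End EilenbergMoore.

Section Top.
Variables (C : abelian_category) (X : functor C C).

Definition top_ob (M : EM X) : C := coker (em_str M).

(* The unique morphism commuting with the projections onto the cokernels. *)
Definition top_map (M N : EM X) (f : hom M N) : hom (top_ob M) (top_ob N) :=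
  projT1 (cid (coker_induced_proof (em_homE f))).

Lemma top_mapE (M N : EM X) (f : hom M N) :
  top_map f \oC coker_map (em_str M) = coker_map (em_str N) \oC em_val f.
Proof. exact: projT2 (cid (coker_induced_proof (em_homE f))). Qed.

Definition top : functor (EM X) C.
Proof.
apply: (@Functor (EM X) C top_ob top_map).
- by move=> M; apply: coker_map_epi; rewrite top_mapE compm1 comp1m.
- move=> M N P g f; apply: coker_map_epi.
  by rewrite top_mapE -compA top_mapE !compA top_mapE.
- move=> M N f g; apply: coker_map_epi.
  by rewrite top_mapE compDl !top_mapE -compDr.
Defined.

Definition no_epi_onto : Prop :=
  forall M : C, ~ is_zero M -> ~ exists f : hom (X M) M, is_epi f.

Definition top_detects_zero : Prop :=
  forall M : EM X, is_zero (top M) <-> is_zero M.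

Definition top_detects_epi : Prop :=
  forall (M N : EM X) (f : hom M N), is_epi (fmap top f) <-> is_epi f.

End Top.

(* Main.v *)
(** Over a biproduct S of the tower X^i(M), whose maps X^i(f) come from
    f : X(M) -> M, the shift s is an endomorphism of S that lowers the index.
    S being a coproduct, 1 - s is left invertible (geometric series, finite on
    each summand); S being a product, compatible families into the tower are the
    morphisms t into S with s t = t, so they vanish and the tower has limit 0.
    If f is epi, so is every X^i(f), X being a left adjoint, and the assumption
    on towers forces M = 0. *)
From mathcomp Require Import all_boot all_algebra boolp.
Require Import Defs.

Set Implicit Arguments.
Unset Strict Implicit.
Unset Printing Implicit Defensive.

Import GRing.Theory.
Local Open Scope ring_scope.
Local Open Scope cat_scope.

Section Preadditive.
Variable C : preadditive.

Lemma is_zeroP (A : C) : is_zero A <-> idm A = 0.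
Proof.
split=> [[/(_ A)[f [_ fU]] _]|A0]; first by rewrite -(fU (idm A)) // (fU 0).
split=> B; exists 0; split=> // f _.
  by rewrite -(compm1 f) A0 compm0.
by rewrite -(comp1m f) A0 comp0m.
Qed.

Lemma hom_from_zero (A B : C) (f : hom A B) : is_zero A -> f = 0.
Proof. by move=> /is_zeroP A0; rewrite -(compm1 f) A0 compm0. Qed.

Lemma hom_to_zero (A B : C) (f : hom A B) : is_zero B -> f = 0.
Proof. by move=> /is_zeroP B0; rewrite -(comp1m f) B0 comp0m. Qed.

Lemma epi_zeroP (A B : C) : is_epi (0 : hom A B) <-> is_zero B.
Proof.
split=> [e0|B0 T g h _]; first by apply/is_zeroP/e0; rewrite !compm0.
by rewrite (hom_from_zero g B0) (hom_from_zero h B0).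
Qed.

Lemma epi_cancel0 (A B T : C) (f : hom A B) (g : hom B T) :
  is_epi f -> g \oC f = 0 -> g = 0.
Proof. by move=> fe gf; apply: fe; rewrite gf comp0m. Qed.

Lemma cokernel_epi (A B Q : C) (f : hom A B) (q : hom B Q) :
  is_cokernel f q -> is_epi q.
Proof.
case=> q0 qU T g h gh.
have [|u [_ uq]] := qU T (h \oC q); first by rewrite -compA q0 compm0.
by rewrite -(uq g) // -(uq h).
Qed.

Lemma cokernel_zeroP (A B Q : C) (f : hom A B) (q : hom B Q) :
  is_cokernel f q -> is_zero Q <-> is_epi f.
Proof.
move=> qP; have [q0 qU] := qP; split=> [Q0 T g h gh|fe].
  have [|u [uq _]] := qU T (g - h); first by rewrite compDl compNl gh subrr.
  by apply/eqP; rewrite -subr_eq0 -uq (hom_from_zero u Q0) comp0m.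
apply/is_zeroP/(cokernel_epi qP).
by rewrite (epi_cancel0 fe q0) !compm0.
Qed.

Lemma coproduct_ext (I : Type) (M : I -> C) (S T : C)
    (inj : forall i, hom (M i) S) (u v : hom S T) :
  is_coproduct inj -> (forall i, u \oC inj i = v \oC inj i) -> u = v.
Proof.
move=> /(_ T (fun i => v \oC inj i))[w [_ wU]] uv.
by rewrite -(wU u) // -(wU v).
Qed.

Lemma product_ext (I : Type) (M : I -> C) (P T : C)
    (pr : forall i, hom P (M i)) (u v : hom T P) :
  is_product pr -> (forall i, pr i \oC u = pr i \oC v) -> u = v.
Proof.
move=> /(_ T (fun i => pr i \oC v))[w [_ wU]] uv.
by rewrite -(wU u) // -(wU v).
Qed.

Lemma biproduct_tower_cone0 (M : nat -> C) (p : forall i, hom (M i.+1) (M i))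
    (T : C) (g : forall i, hom T (M i)) :
  has_biproduct M -> (forall i, p i \oC g i.+1 = g i) -> forall i, g i = 0.
Proof.
case=> S [P [inj [pr [c [Sco Ppr [c1 c0] [d [dc cd]]]]]]] gP.
(* The shift: the summand of index j+1 goes by [p j] to the summand of index j, and the summand of
   index 0 is killed. *)
pose s_ i : hom (M i) S :=
  if i is j.+1 return hom (M i) S then inj j \oC p j else 0.
have [s [sE _]] := Sco S s_.
(* On the summand of index i this is the sum of the powers of [s] from 0 to i, hence the geometric
   series inverting 1 - s from the left. *)
pose fix v_ i : hom (M i) S :=
  if i is j.+1 return hom (M i) S then inj j.+1 + v_ j \oC p j else inj 0%N.
have [v [vE _]] := Sco S v_.
have vs : v \oC (idm S - s) = idm S.
  apply: (coproduct_ext Sco) => -[|i].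
    by rewrite -compA compDl compNl sE subr0 !comp1m vE.
  rewrite -compA compDl compNl sE !comp1m compDr compNr compA !vE /=.
  by rewrite addrK.
(* In terms of product components, [s] replaces the component of index i by [p i] applied to the one
   of index i+1. *)
have prs i : pr i \oC c \oC s = p i \oC (pr i.+1 \oC c).
  apply: (coproduct_ext Sco) => -[|j]; rewrite -!compA sE /=.
    by rewrite !compm0 !compA -(compA (p i)) -(compA (p i)) c0 // compm0.
  rewrite !compA -(compA (p i)) -(compA (p i)).
  have [<-|/eqP ij] := eqVneq j i; first by rewrite !c1 comp1m compm1.
  by rewrite !c0 ?comp0m ?compm0 // => -[].
have [t [tE _]] := Ppr T g.
have prt i : pr i \oC c \oC (d \oC t) = g i.
  by rewrite -!compA (compA c) cd comp1m tE.
have st : s \oC (d \oC t) = d \oC t.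
  suff /(congr1 (comp d)) : c \oC (s \oC (d \oC t)) = c \oC (d \oC t).
    by rewrite !(compA d) dc !comp1m.
  apply: (product_ext Ppr) => i.
  by rewrite !compA prs -!compA !(compA (pr _)) !prt gP.
have t0 : d \oC t = 0.
  by rewrite -[LHS]comp1m -vs -compA compDl compNl comp1m st subrr compm0.
by move=> i; rewrite -prt t0 compm0.
Qed.

End Preadditive.

Section LeftAdjoint.
Variables (C D : preadditive) (F : functor C D) (G : functor D C).
Hypothesis FG : left_adjoint F G.

Lemma left_adjoint_epi (A B : C) (f : hom A B) : is_epi f -> is_epi (fmap F f).
Proof.
have [phi [phib phil _]] := FG => fe T g h gh.
by apply: (bij_inj (phib _ _)); apply: fe; rewrite -!phil gh.
Qed.

(** Factorisations are transported along the adjunction bijection; they are unique because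
    [fmap F q] is again epi. *)
Lemma left_adjoint_cokernel (A B Q : C) (f : hom A B) (q : hom B Q) :
  is_cokernel f q -> is_cokernel (fmap F f) (fmap F q).
Proof.
move=> qP; have [q0 qU] := qP; split=> [|T g gf]; first by rewrite -fmapM q0 fmap0.
have [phi [phib phil _]] := FG.
(* [phi] is only a natural bijection, not additive by definition; it preserves 0 by naturality,
   since 0 factors through [fmap F 0]. *)
have phi0 E : phi E T 0 = 0.
  by rewrite -[0](comp0m _ (fmap F (0 : hom E E))) phil compm0.
have [|u [uq _]] := qU _ (phi _ _ g); first by rewrite -phil gf phi0.
have [psi _ psiK] := phib Q T.
exists (psi u); split=> [|v vq].
  by apply: (bij_inj (phib _ _)); rewrite phil psiK.
apply: (left_adjoint_epi (cokernel_epi qP)); rewrite vq.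
by apply: (bij_inj (phib _ _)); rewrite phil psiK.
Qed.

End LeftAdjoint.

Lemma em_zeroP (C : preadditive) (X : functor C C) (M : EM X) :
  is_zero M <-> is_zero (em_base M).
Proof.
by split=> /is_zeroP M0; apply/is_zeroP; [exact: (congr1 val M0)|exact: val_inj].
Qed.

(** The forgetful functor is faithful, so it reflects epimorphisms. *)
Lemma em_val_epi (C : preadditive) (X : functor C C) (M N : EM X)
    (f : hom M N) : is_epi (em_val f) -> is_epi f.
Proof.
by move=> fe T g h gh; apply/val_inj/fe; exact: (congr1 val gh).
Qed.

Section Top.
Variables (C : abelian_category) (X : functor C C).

Lemma top_zeroP (M : EM X) : is_zero (top X M) <-> is_epi (em_str M).
Proof. exact: cokernel_zeroP (coker_mapP _). Qed.

(* [top X] is left adjoint to M |-> (M, 0). *)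
Lemma top_epi (M N : EM X) (f : hom M N) : is_epi f -> is_epi (fmap (top X) f).
Proof.
move=> fe T g h gh; apply: coker_map_epi.
pose T0 : EM X := @EMObj C X T 0.
have q0 := (coker_mapP (em_str N)).1.
have lift (k : hom (top X N) T) : k \oC coker_map (em_str N) \in em_mor (M:=N) (N:=T0).
  by apply/eqP; rewrite -compA q0 compm0 comp0m.
suff /(congr1 val) : EMHom (lift g) = EMHom (lift h) by [].
apply: fe; apply: val_inj => /=.
by rewrite -!compA -top_mapE !compA gh.
Qed.

(** An epimorphism from X(M) to M is the same thing as an object of [EM X] over M with zero top. *)
Lemma no_epi_onto_top_zero : no_epi_onto X <-> top_detects_zero X.
Proof.
split=> [H M|H M Mn0 [f fe]].
  rewrite top_zeroP em_zeroP; split=> [he|M0].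
    by apply: contrapT => Mn0; apply: (H _ Mn0); exists (em_str M).
  by rewrite (hom_to_zero (em_str M) M0); apply/epi_zeroP.
have /H/em_zeroP// : is_zero (top X (@EMObj C X M f)) by apply/top_zeroP.
Qed.

(** Apply the hypothesis to the zero endomorphism of [M]: a zero morphism is epi exactly when its
    target is zero. *)
Lemma top_detects_epi_zero : top_detects_epi X -> top_detects_zero X.
Proof.
move=> H M; rewrite -(epi_zeroP M) -H fmap0; split=> [|/epi_zeroP//].
by move=> /epi_zeroP.
Qed.

Variable Y : functor C C.
Hypothesis XY : left_adjoint X Y.

(** As a left adjoint, X preserves cokernels, so the cokernel taken in C inherits a structure map
    that makes the projection a morphism of [EM X]. *)
Lemma em_cokernel (M N : EM X) (f : hom M N) :
  exists (Q : EM X) (q : hom N Q), is_cokernel (em_val f) (em_val q).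
Proof.
have qP := coker_mapP (em_val f); have [q0 _] := qP.
have [_ /(_ _ (coker_map (em_val f) \oC em_str N))] := left_adjoint_cokernel XY qP.
case=> [|h [hq _]]; first by rewrite -compA -em_homE compA q0 comp0m.
have qm : coker_map (em_val f) \in em_mor (M:=N) (N:=EMObj h) by apply/eqP.
by exists (EMObj h), (EMHom qm).
Qed.

Lemma top_detects_zero_epi : top_detects_zero X -> top_detects_epi X.
Proof.
move=> H M N f; split=> [tfe|]; last exact: top_epi.
have [Q [q qP]] := em_cokernel f.
(* It suffices that the cokernel [Q] vanishes, and by hypothesis only its top has to be shown zero:
   top q kills the epimorphism top f. *)
apply/em_val_epi/(cokernel_zeroP qP)/em_zeroP/H/is_zeroP.
apply: coker_map_epi; rewrite comp1m comp0m.
apply: (epi_cancel0 (cokernel_epi qP)); rewrite -top_mapE.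
suff -> : top_map q = 0 by rewrite comp0m.
apply: (epi_cancel0 tfe); rewrite -[LHS](fmapM (top X)).
suff -> : q \oC f = 0 by rewrite fmap0.
exact/val_inj/qP.1.
Qed.

Lemma towers_no_epi_onto :
  (forall M : C, has_biproduct (fun i : nat => iter i X M)) ->
  epi_towers_have_nonzero_limits C -> no_epi_onto X.
Proof.
move=> biX H M Mn0 [f fe].
pose fix p i : hom (iter i.+1 X M) (iter i X M) :=
  if i is j.+1 return hom (iter i.+1 X M) (iter i X M)
  then fmap X (p j) else f.
have pe i : is_epi (p i).
  by elim: i => [//|i IHi]; exact: (left_adjoint_epi XY).
(* All cones over the tower vanish, so the zero object is a limit, against the assumption on
   towers. *)
have [Z Z0] := zero_object (abelianP C).
apply: (H (fun i => iter i X M) p pe Mn0 Z (fun=> 0)) => //.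
split=> [i|T g gP]; first by rewrite compm0.
have g0 := biproduct_tower_cone0 (biX M) gP.
exists 0; split=> [i|u _]; first by rewrite g0 comp0m.
by rewrite (hom_to_zero u).
Qed.

End Top.

(** An epimorphism [e] from a projective onto [M 0] lifts step by step to a cone over the tower, so
    it factors through the limit; a zero limit would make [e] zero, and [M 0] with it. *)
Lemma enough_projectives_towers (C : preadditive) :
  enough_projectives C -> epi_towers_have_nonzero_limits C.
Proof.
move=> enP M p pe M0 L pr [_ LU] L0; apply: M0.
have [P [e [Pproj ee]]] := enP (M 0%N).
pose fix g i : hom P (M i) :=
  if i is j.+1 return hom P (M i) then projT1 (cid (Pproj _ _ _ (pe j) (g j)))
  else e.
have [|u [uE _]] := LU P g.
  by move=> i; exact: projT2 (cid (Pproj _ _ _ (pe i) (g i))).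
apply/(epi_zeroP P); rewrite -(_ : e = 0) //.
by rewrite -[e](uE 0%N) (hom_from_zero (pr 0%N) L0) comp0m.
Qed.

Theorem lemma6p27 (C : abelian_category) (X Y : functor C C)
    (Y_left_adjoint : left_adjoint Y X) (Y_right_adjoint : left_adjoint X Y)
    (biproductsX : forall M : C, has_biproduct (fun i : nat => iter i X M))
    (biproductsY : forall M : C, has_biproduct (fun i : nat => iter i Y M)) :
  ((no_epi_onto X <-> top_detects_zero X) /\
   (top_detects_zero X <-> top_detects_epi X) /\
   (epi_towers_have_nonzero_limits C ->
      [/\ no_epi_onto X, top_detects_zero X & top_detects_epi X])) /\
  (enough_projectives C -> epi_towers_have_nonzero_limits C).
Proof.
have zero_epi := top_detects_zero_epi Y_right_adjoint.
split; last exact: enough_projectives_towers.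
split; first exact: no_epi_onto_top_zero.
split; first by split; [|exact: top_detects_epi_zero].
move=> /(towers_no_epi_onto Y_right_adjoint biproductsX) H1.
by have H2 := (no_epi_onto_top_zero X).1 H1; split=> //; exact: zero_epi.
Qed.
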